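(* Fix $q\in[0,1)$. Let $(\Pi_n)_{n\in\mathbb{N}}$ be coupled through the infinite Bernoulli model (so each $\Pi_n$ is $\pi_{n,q}$-distributed). Let $d_n$ be the graph distance on $\mathrm{BST}(\Pi_n)$ and $\mu_n$ the uniform probability measure on its nodes. Then $$d_{\mathrm{GHP}}\Big(\big(\mathrm{BST}(\Pi_n),((1-q)n)^{-1}d_n,\mu_n\big),\ \big([0,1],|\cdot-\cdot|,\mathrm{Leb}_{[0,1]}\big)\Big)\longrightarrow0\quad\text{almost surely},$$ where $\mathrm{Leb}_{[0,1]}$ is the uniform (Lebesgue) measure on $[0,1]$.
   Context: $\pi_{n,q}(\sigma)=q^{\mathrm{Inv}(\sigma)}/Z_{n,q}$ on $S_n$, $\mathrm{Inv}(\sigma)=|\{i<j:\sigma(i)>\sigma(j)\}|$, $0^0=1$. Infinite Bernoulli model: $(B_{i,j})_{i,j\ge1}$ independent Bernoulli$(1-q)$, $I_i=\min\{j\notin\{I_1,\dots,I_{i-1}\}:B_{i,j}=1\}$, and $\Pi_n$ is the permutation of $\{1,\dots,n\}$ giving the relative order of $(I_1,\dots,I_n)$, i.e. $\Pi_n(i)=|\{j\le n:I_j\le I_i\}|$. $\mathbb{T}$ is the set of finite words over $\{0,1\}$ with root $\varnothing$ and edges $\{w,w0\},\{w,w1\}$; $aS=\{aw:w\in S\}$. For a finite sequence $x=(x_1,\dots,x_n)$ of distinct numbers, $\mathrm{BST}(x)=\emptyset$ if $n=0$, else $\{\varnothing\}\cup0\,\mathrm{BST}(x_-)\cup1\,\mathrm{BST}(x_+)$,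 $x_-$ (resp. $x_+$) being the subsequence of entries smaller (resp. larger) than $x_1$ in original order; $\mathrm{BST}(\sigma)=\mathrm{BST}(\sigma(1),\dots,\sigma(n))$. GHP distance: for weighted metric spaces $\mathcal{E}_i=(E_i,d_i,\mu_i)$ ($(E_i,d_i)$ compact, $\mu_i$ Borel probability), a correspondence is $C\subseteq E_1\times E_2$ whose projections are $E_1$ and $E_2$, with distortion $\mathrm{dis}(C)=\sup\{|d_1(x_1,x_1')-d_2(x_2,x_2')|:(x_1,x_2),(x_1',x_2')\in C\}$; a coupling is a probability measure $M$ on $E_1\times E_2$ with marginals $\mu_1,\mu_2$. $d_{\mathrm{GHP}}(\mathcal{E}_1,\mathcal{E}_2)=\inf\{\varepsilon>0:\exists (C,M),\ M(C)\ge1-\varepsilon,\ \mathrm{dis}(C)\le2\varepsilon\}$. *)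

(* Defs.v *)
From HB Require Import structures.
From mathcomp Require Import all_boot all_order all_algebra.
From mathcomp Require Import all_classical all_reals all_analysis.

Set Implicit Arguments.
Unset Strict Implicit.
Unset Printing Implicit Defensive.

Import Order.TTheory GRing.Theory Num.Theory.
Import numFieldNormedType.Exports.
Local Open Scope classical_set_scope.
Local Open Scope ring_scope.

(* Words over {0,1}: vertices of the infinite binary tree T.              *)
(* false = letter 0, true = letter 1.                                     *)
Definition word : Type := seq bool.
HB.instance Definition _ := Choice.on word.
HB.instance Definition _ := isPointed.Build word [::].
HB.instance Definition _ := @isMeasurable.Build default_measure_display
  word discrete_measurable discrete_measurable0
  discrete_measurableC discrete_measurableU.

Definition tree_adj (u v : word) : bool :=
  [|| v == rcons u false, v == rcons u true,
      u == rcons v false | u == rcons v true].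

(* graph distance in the subgraph of T induced by the finite node set S:
   the minimal length of a path u = p_0, p_1, ..., p_k = v with all p_i in S
   (default 0 if no such path exists or if u, v are not in S) *)
Definition path_in (S : seq word) (u v : word) (k : nat) : Prop :=
  exists p : seq word, [/\ size p = k, path tree_adj u p, last u p = v,
                           u \in S & all (mem S) p].

Definition graph_dist (S : seq word) (u v : word) : nat :=
  match pselect (exists k, path_in S u v k) with
  | left ex => ex_minn (P := fun k => `[< path_in S u v k >]) 
                 (let: ex_intro k hk := ex in ex_intro _ k (asboolT hk))
  | right _ => 0
  end.

(* (fuel = size x, which always suffices since x_-, x_+ are shorter)      *)
Fixpoint bst_fuel (k : nat) (x : seq nat) : seq word :=
  match k, x with
  | 0, _ => [::]
  | _, [::] => [::]
  | k'.+1, a :: s =>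
      [::] :: (map (cons false) (bst_fuel k' [seq y <- s | (y < a)%N])
               ++ map (cons true) (bst_fuel k' [seq y <- s | (a < y)%N]))
  end.

Definition bst (x : seq nat) : seq word := bst_fuel (size x) x.

(* Infinite Bernoulli model.  Rows/columns are indexed from 0 (the paper  *)
(* indexes from 1; this shift does not change relative orders).           *)
(* b i j plays the role of B_{i+1,j+1}.                                   *)
(* smallest j not in [used] with b j = true (default 0 if none exists;    *)
(* for q < 1 such a j exists almost surely)                               *)
Definition first_free (b : nat -> bool) (used : seq nat) : nat :=
  match pselect (exists j, (j \notin used) && b j) with
  | left ex => @ex_minn (fun j => (j \notin used) && b j) ex
  | right _ => 0%N
  end.

Fixpoint Iseq (b : nat -> nat -> bool) (n : nat) : seq nat :=
  match n with
  | 0 => [::]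
  | n'.+1 => let s := Iseq b n' in rcons s (first_free (b n') s)
  end.

Definition rel_order (s : seq nat) : seq nat :=
  [seq count (fun y => (y <= x)%N) s | x <- s].

Definition Pi (b : nat -> nat -> bool) (n : nat) : seq nat :=
  rel_order (Iseq b n).

(* uniform probability measure on the (duplicate-free) node list S *)
Definition unif_nodes {R : realType} (S : seq word) : set word -> \bar R :=
  fun A => (((size S)%:R^-1)%:E * (\sum_(w <- S) (@dirac _ word w R A)))%E.

Definition leb01 {R : realType} : set R -> \bar R :=
  fun A => lebesgue_measure (A `&` `[0%R, 1%R]).

Definition dGHP {R : realType} {d1 d2 : measure_display}
  {T1 : measurableType d1} {T2 : measurableType d2}
  (E1 : set T1) (r1 : T1 -> T1 -> R) (m1 : set T1 -> \bar R)
  (E2 : set T2) (r2 : T2 -> T2 -> R) (m2 : set T2 -> \bar R) : R :=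
  inf [set eps : R | (0 < eps)%R /\
    exists (C : set (T1 * T2)%type) (M : {measure set (T1 * T2)%type -> \bar R}),
      [/\
          [/\ measurable C, C `<=` E1 `*` E2, fst @` C = E1 & snd @` C = E2],
          (forall x y, C x -> C y -> `|r1 x.1 y.1 - r2 x.2 y.2| <= 2 * eps),
          (forall A, measurable A -> M (A `*` setT) = m1 A),
          (forall B, measurable B -> M (setT `*` B) = m2 B) &
          ((1 - eps)%:E <= M C)%E]].

Definition ghp_bst {R : realType} (q : R) (b : nat -> nat -> bool) (n : nat) : R :=
  let S := bst (Pi b n) in
  dGHP [set w | w \in S]
       (fun u v => (graph_dist S u v)%:R / ((1 - q) * n%:R)) (@unif_nodes R S)
       (`[0%R, 1%R] : set R) (fun x y : R => `|x - y|) (@leb01 R).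

Definition bernoulli_iid_family {R : realType} {d : measure_display}
  {T : measurableType d} (P : probability T R) (q : R)
  (B : nat -> nat -> T -> bool) : Prop :=
  [/\ (forall i j, measurable [set w | B i j w]),
      (forall i j, P [set w | B i j w] = (1 - q)%:E) &
      (forall (s : seq (nat * nat)) (v : nat * nat -> bool), uniq s ->
         P (\bigcap_(k in [set` s]) [set w | B k.1 k.2 w = v k]) =
         (\prod_(k <- s) P [set w | B k.1 k.2 w = v k])%E)].

(* Main.v *)
Require Import Defs.
From HB Require Import structures.
From mathcomp Require Import all_boot all_order all_algebra.
From mathcomp Require Import all_classical all_reals all_analysis.
From mathcomp Require Import zify ring lra.
Import Order.TTheory GRing.Theory Num.Theory.
Import numFieldNormedType.Exports.
Local Open Scope classical_set_scope.
Local Open Scope ring_scope.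

(** Write [p = 1 - q]. The right spine of the tree consists of the records
    (left-to-right maxima) of [I_1, ..., I_n], and the first [k] spine nodes
    together with their left subtrees contain exactly the values up to the
    [k]-th record. If that record is set at time [i], their number [N_k] lies
    between [i] and [max (I_1, ..., I_i)], while [k] is the number of records up
    to time [i]. So it suffices that almost surely the maximum is [n + o(n)] and
    the number of records is [p n + o(n)]: then [N_k = k / p + o(n)] uniformly in
    [k], hence the spine carries the mass linearly and every left subtree has
    size [o(n)].

    The event [(I_1, ..., I_n) = s] is a cylinder of probability
    [\prod_i p q ^ (gaps below s_i)]. Summing these weights over the injective
    words [s] in [{0, ..., L - 1}] bounds the probability that the maximum exceeds
    [L], and shows that [z ^ max * y ^ records] is a supermartingale whenever
    [p z y = 1 - q z], which gives exponential deviation bounds for the number of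
    records. Borel-Cantelli concludes. For the coupling, the nodes are sorted by
    spine index and the [j]-th one receives the interval [(j / n, (j + 1) / n]]. *)

(** * Records and the spine of the search tree *)

(** The threshold [m] is one more than the running maximum, so that [recs 0 s] lists all
    left-to-right maxima of [s]. *)
Fixpoint recs (m : nat) (s : seq nat) : seq nat :=
  if s is a :: s' then
    if (m <= a)%N then a :: recs a.+1 s' else recs m s'
  else [::].

Definition nrec (s : seq nat) : nat := size (recs 0 s).

(** With the successor, the empty word has value 0 and [top s <= j] says that appending [j] sets a
    record. *)
Definition top (s : seq nat) : nat := \max_(x <- s) x.+1.

Lemma top_nil : top [::] = 0%N. Proof. by rewrite /top big_nil. Qed.

Lemma top_cons a s : top (a :: s) = maxn a.+1 (top s).
Proof. by rewrite /top big_cons. Qed.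

Lemma top_rcons s j : top (rcons s j) = maxn (top s) j.+1.
Proof. by rewrite /top -cats1 big_cat big_seq1. Qed.

Lemma lt_top s x : x \in s -> (x < top s)%N.
Proof. by move=> xs; rewrite /top (big_rem x) //= leq_maxl. Qed.

Lemma size_le_top s : uniq s -> (size s <= top s)%N.
Proof.
move=> us; rewrite -(size_iota 0 (top s)); apply: uniq_leq_size => // x /lt_top.
by rewrite mem_iota.
Qed.

Lemma recs_rcons m s j : recs m (rcons s j) =
  if (maxn m (top s) <= j)%N then rcons (recs m s) j else recs m s.
Proof.
elim: s m => [|a s IH] m /=; first by rewrite top_nil maxn0.
rewrite top_cons; case: ifP => ma.
  rewrite IH; have -> : maxn m (maxn a.+1 (top s)) = maxn a.+1 (top s) by lia.
  by case: ifP.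
by rewrite IH; have -> : maxn m (maxn a.+1 (top s)) = maxn m (top s) by lia.
Qed.

Lemma nrec_rcons s j : nrec (rcons s j) = (nrec s + (top s <= j))%N.
Proof.
rewrite /nrec recs_rcons max0n; case: ifP => _; last by rewrite addn0.
by rewrite size_rcons addn1.
Qed.

Lemma recs_filter m a s : (a <= m)%N ->
  recs m [seq y <- s | (a <= y)%N] = recs m s.
Proof.
elim: s m => //= b s IH m am; case: (leqP m b) => mb /=; last first.
  by case: ifP => //= _; rewrite ?ifF ?IH //; lia.
by rewrite (leq_trans am mb) /= mb IH //; lia.
Qed.

Lemma recs_all m s : all (fun y => m <= y)%N s -> recs m s = recs 0 s.
Proof. by case: s => //= a s /andP[-> _]. Qed.

(** This is the recursion of the right spine: the later records are those of the subsequence that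
    builds the right subtree of the root [a]. *)
Lemma recs_cons_filter a s :
  recs 0 (a :: s) = a :: recs 0 [seq y <- s | (a < y)%N].
Proof. by rewrite /= -(recs_filter a.+1 a.+1 s (leqnn _)) recs_all // filter_all. Qed.

Lemma mem_recs m s x : x \in recs m s -> x \in s.
Proof.
elim: s m => //= a s IH m; case: ifP => _; last first.
  by move/IH; rewrite inE => ->; rewrite orbT.
by rewrite !inE => /orP[->//|/IH ->]; rewrite orbT.
Qed.

(** The prefix ends at the time when the record is set; the record is then the maximum so far. *)
Lemma nth_recs_take s k : (k < nrec s)%N ->
  exists i, [/\ (i <= size s)%N, nrec (take i s) = k.+1 &
                top (take i s) = (nth 0 (recs 0 s) k).+1].
Proof.
elim/last_ind: s => // s j IH; rewrite nrec_rcons /nrec recs_rcons max0n.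
have [ks _|sk] := ltnP k (nrec s).
  have [i [il ir it]] := IH ks; exists i; rewrite size_rcons.
  rewrite -cats1 takel_cat //; split => //; first exact: leqW.
  by rewrite it; case: ifP => // _; rewrite nth_rcons -/(nrec s) ks.
move: sk; rewrite /nrec => sk; case: (leqP (top s) j) => tj;
  last by rewrite addn0 ltnNge sk.
rewrite addn1 ltnS => ks; have -> : k = size (recs 0 s) by lia.
exists (size (rcons s j)); rewrite take_size; split => //.
  by rewrite recs_rcons max0n tj size_rcons.
by rewrite nth_rcons ltnn eqxx top_rcons; lia.
Qed.

(* The index of the spine node that is [w] or has [w] in its left subtree. *)
Definition lead (w : word) : nat := find negb w.

(** * Binary search trees and the left subtrees of the spine *)

Lemma bst_fuel_map (f : nat -> nat) k x :
  {in x &, forall a b, (f a < f b)%N = (a < b)%N} ->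
  bst_fuel k (map f x) = bst_fuel k x.
Proof.
elim: k x => //= k IH [//|a s] mf /=.
have mf' (P : pred nat) :
    {in [seq y <- s | P y] &, forall a b, (f a < f b)%N = (a < b)%N}.
  move=> u v; rewrite !mem_filter => /andP[_ us] /andP[_ vs].
  by apply: mf; rewrite inE ?us ?vs orbT.
rewrite !filter_map; congr (_ :: (_ ++ _)).
  rewrite -(IH [seq y <- s | (y < a)%N]) //; congr (map _ (bst_fuel _ (map _ _))).
  apply: eq_in_filter => y ys /=; apply: mf; by rewrite inE ?eqxx ?ys ?orbT.
rewrite -(IH [seq y <- s | (a < y)%N]) //; congr (map _ (bst_fuel _ (map _ _))).
by apply: eq_in_filter => y ys /=; apply: mf; rewrite inE ?eqxx ?ys ?orbT.
Qed.

(** Ranks are strictly increasing in the value, and the tree depends on comparisons only. So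
    [I_1, ..., I_n] can replace [Pi_n]; these values do not change with [n]. *)
Lemma bst_rel_order s : bst (rel_order s) = bst s.
Proof.
rewrite /bst /rel_order size_map; apply: bst_fuel_map => a b as_ bs.
have le u v : (u <= v)%N ->
    (count (fun y => y <= u)%N s <= count (fun y => y <= v)%N s)%N.
  by move=> uv; apply: sub_count => y /= /leq_trans; apply.
case: (ltnP a b) => ab; last by apply/negbTE; rewrite -leqNgt; apply: le.
have -> t : count (fun y => y <= b)%N t =
    (count (fun y => y <= a) t + count (fun y => a < y <= b) t)%N.
  elim: t => //= y t ->.
  by case: (leqP y a); case: (leqP y b) => /=; lia.
rewrite -[ltnLHS]addn0 ltn_add2l -has_count; apply/hasP; exists b => //.
by rewrite ab /=.
Qed.

Lemma lead_cons c w : lead (c :: w) = if c then (lead w).+1 else 0%N.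
Proof. by case: c. Qed.

Section BST.

Let subsize (P : pred nat) k a s : (size (a :: s) <= k.+1)%N ->
  (size [seq y <- s | P y] <= k)%N.
Proof. by rewrite ltnS => /(leq_trans _); apply; rewrite size_filter count_size. Qed.

Lemma size_bst_fuel k x : uniq x -> (size x <= k)%N -> size (bst_fuel k x) = size x.
Proof.
elim: k x => [|k IH] [|a s] //= /andP[as_ us] sk.
rewrite size_cat !size_map !IH ?filter_uniq ?(subsize _ _ a) // !size_filter.
rewrite -(count_predC (fun y => y < a)%N s); congr (_ + _).+1%N.
apply: eq_in_count => y ys /=; rewrite -leqNgt ltn_neqAle.
by case: eqP ys as_ => [->->|].
Qed.

Lemma bst_fuel_uniq k x : uniq (bst_fuel k x).
Proof.
elim: k x => [|k IH] [|a s] //=; rewrite cat_uniq !map_inj_uniq ?IH; try by move=> ? ? [].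
rewrite andbT /= mem_cat; apply/andP; split.
  by rewrite negb_or; apply/andP; split; apply/mapP => -[].
by apply/hasPn => w /mapP[v _ ->]; apply/mapP => -[].
Qed.

Lemma bst_fuel_prefix k x u r : u ++ r \in bst_fuel k x -> u \in bst_fuel k x.
Proof.
elim: k x u => [|k IH] [|a s] //= [|c u]; first by rewrite !inE eqxx.
rewrite !inE /= !mem_cat => /orP[]/mapP[w wS [-> e]]; apply/orP; [left|right].
  by apply/mapP; exists u => //; apply: IH; rewrite e.
by apply/mapP; exists u => //; apply: IH; rewrite e.
Qed.

Lemma lead_bst_fuel k x w : w \in bst_fuel k x -> (lead w < nrec x)%N.
Proof.
elim: k x w => [|k IH] [|a s] //= w; rewrite /nrec recs_cons_filter inE mem_cat.
case/orP=> [/eqP->//|/orP[]/mapP[v /IH lv ->]]; rewrite lead_cons //=.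
Qed.

(** Induction along the right spine: the root and its left subtree have [lead] 0 and hold the
    entries up to the first one, while in the right subtree [lead] and the record index both shift
    by one. *)
Lemma count_lead_bst_fuel k x l : uniq x -> (size x <= k)%N -> (l < nrec x)%N ->
  count (fun w => lead w <= l)%N (bst_fuel k x) =
  count (fun y => y <= nth 0 (recs 0 x) l)%N x.
Proof.
elim: k x l => [|k IH] [|a s] l // uas sk.
have /andP[as_ us] : (a \notin s) && uniq s by [].
rewrite /nrec (recs_cons_filter a s) [size (_ :: _)]/= ltnS => ln.
rewrite [bst_fuel _ _]/= [LHS]/= count_cat !count_map.
have eA : count (preim (cons false) (fun w => lead w <= l)%N)
    (bst_fuel k [seq y <- s | (y < a)%N]) = count (fun y => y < a)%N s.
  by rewrite -[RHS]size_filter -[RHS](size_bst_fuel k) ?filter_uniq ?(subsize _ _ a).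
rewrite eA add1n; case: l ln {eA} => [_|l ln] /=.
  rewrite [X in (_ + X)%N](eq_count (a2 := pred0)) ?count_pred0 //.
  rewrite leqnn addn0 add1n; congr _.+1; apply: eq_in_count => y ys.
  have ya : y != a by apply: contraNneq as_ => <-.
  by rewrite [RHS]leq_eqVlt (negbTE ya).
rewrite -(eq_count (a1 := fun w => lead w <= l)%N) //.
rewrite IH ?filter_uniq ?(subsize _ _ a) //.
set r := nth _ _ _.
have ar : (a < r)%N.
  have /mem_recs : r \in recs 0 [seq y <- s | (a < y)%N] by apply: mem_nth.
  by rewrite mem_filter => /andP[].
rewrite (ltnW ar) add1n; congr _.+1; rewrite count_filter.
(* Since [a] is not in [s], the entries of [s] up to [r > a] are those below [a] and those strictly
   above [a] and at most [r]. *)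
elim: s as_ {us uas sk ln IH} r ar => // y s IHs.
rewrite inE negb_or => /andP[ay as_] r ar /=.
by rewrite -(IHs as_ r ar) /=; case: (ltngtP a y) ay => //= ay _; lia.
Qed.

End BST.

Lemma Iseq_take b n i : (i <= n)%N -> Iseq b i = take i (Iseq b n).
Proof.
have sI m : size (Iseq b m) = m by elim: m => //= m; rewrite size_rcons => ->.
elim: n => [|n IH]; first by rewrite leqn0 => /eqP->.
rewrite leq_eqVlt => /orP[/eqP->|]; first by rewrite -{2}(sI n.+1) take_size.
by rewrite ltnS => i_n; rewrite /= -cats1 takel_cat ?sI // IH.
Qed.

Lemma size_Iseq b n : size (Iseq b n) = n.
Proof. by elim: n => //= n; rewrite size_rcons => ->. Qed.

(* The first k spine nodes of the tree, with their left subtrees, hold exactly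
   the values up to the k-th record; at the time i when that record is
   set, these include the i values seen so far. *)
Lemma count_lead_bst b n k : uniq (Iseq b n) -> (k <= nrec (Iseq b n))%N ->
  exists i, [/\ (i <= n)%N, nrec (Iseq b i) = k,
    (i <= count (fun w => lead w < k)%N (bst (Pi b n)))%N &
    (count (fun w => lead w < k)%N (bst (Pi b n)) <= top (Iseq b i))%N].
Proof.
rewrite /Pi bst_rel_order /bst => us; case: k => [_|k kn].
  exists 0%N; split => //; by rewrite (eq_count (a2 := pred0)) ?count_pred0.
have [i []] := nth_recs_take _ _ kn; rewrite size_Iseq => i_n.
rewrite -Iseq_take // => ni ti; exists i.
split => //; rewrite count_lead_bst_fuel ?size_Iseq //.
  move: ti; set r := nth _ _ _ => ti.
  (* Lower bound: each of the first [i] values is at most the record [r]. *)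
  have : all (fun y => y <= r)%N (take i (Iseq b n)).
    by apply/allP => y /lt_top; rewrite -Iseq_take // ti ltnS.
  rewrite all_count -Iseq_take // size_Iseq => /eqP {1}<-.
  rewrite (Iseq_take b n i) // -[X in (_ <= count _ X)%N](cat_take_drop i).
  by rewrite count_cat leq_addr.
(* Upper bound: the values are distinct, and only [r + 1] naturals are at most [r]. *)
rewrite ti -(size_iota 0 (nth 0 _ k).+1) -size_filter; apply: uniq_leq_size.
  exact: filter_uniq.
by move=> y; rewrite mem_filter mem_iota => /andP[].
Qed.

(** * Graph distance in a prefix-closed set of words *)

Lemma path_in_trans S u v w k l :
  path_in S u v k -> path_in S v w l -> path_in S u w (k + l).
Proof.
move=> [p [pk pp pv uS pS]] [r [rl rp rw vS rS]]; exists (p ++ r).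
by rewrite size_cat pk rl cat_path pp pv rp last_cat pv rw all_cat pS rS; split.
Qed.

Lemma tree_adj_sym : symmetric tree_adj.
Proof.
by move=> u v; rewrite /tree_adj orbA orbC -orbA.
Qed.

Lemma path_in_sym S u v k : path_in S u v k -> path_in S v u k.
Proof.
move=> [p [pk pp pv uS pS]]; exists (rev (belast u p)); split.
- by rewrite size_rev size_belast.
- by rewrite -pv rev_path (eq_path (e' := tree_adj)) // => x y; rewrite tree_adj_sym.
- by case: p pv {pk pp pS} => [<-//|a p _] /=; rewrite rev_cons last_rcons.
- by rewrite -pv; have := mem_last u p; rewrite inE => /orP[/eqP->//|/(allP pS)].
- by rewrite all_rev; apply/allP => x /mem_belast; rewrite inE => /orP[/eqP->//|/(allP pS)].
Qed.

(** Excludes the default value 0 of [graph_dist] as soon as one path is known. *)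
Lemma path_in_graph_dist S u v k : path_in S u v k ->
  path_in S u v (graph_dist S u v) /\ (graph_dist S u v <= k)%N.
Proof.
move=> uvk; rewrite /graph_dist; case: pselect => [ex|[]]; last by exists k.
by case: ex_minnP => m /asboolP ? mn; split => //; apply: mn; apply/asboolP.
Qed.

Definition prefix_closed (S : seq word) :=
  forall u r : word, u ++ r \in S -> u \in S.

Lemma path_in_cat S u r : prefix_closed S -> u ++ r \in S ->
  path_in S u (u ++ r) (size r).
Proof.
move=> clS; elim/last_ind: r => [|r c IH] uS.
  by rewrite cats0 in uS *; exists [::].
rewrite -rcons_cat in uS *.
have urS : u ++ r \in S by apply: (clS _ [:: c]); rewrite cats1.
rewrite size_rcons -addn1; apply: path_in_trans (IH urS) _.
exists [:: rcons (u ++ r) c]; split => //=; last by rewrite uS.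
by rewrite /tree_adj; case: c uS; rewrite eqxx ?orbT.
Qed.

(** The prefix [nseq (lead w) true] is the spine ancestor of [w]. *)
Lemma lead_split w : w = nseq (lead w) true ++ drop (lead w) w.
Proof. by elim: w => [|[] w IH] //=; rewrite {1}IH. Qed.

Lemma lead_size w : (lead w <= size w)%N.
Proof. exact: find_size. Qed.

Lemma tree_adj_lead u v : tree_adj u v ->
  (lead u <= (lead v).+1)%N /\ (lead v <= (lead u).+1)%N.
Proof.
have H w c : (lead w <= lead (rcons w c) <= (lead w).+1)%N.
  by elim: w => [|[] w IH] //=; case: c.
by case/or4P => /eqP->; split; have := H u false; have := H u true;
  have := H v false; have := H v true; lia.
Qed.

Lemma path_lead u p : path tree_adj u p ->
  (lead u <= lead (last u p) + size p)%N /\ (lead (last u p) <= lead u + size p)%N.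
Proof.
elim: p u => [|a p IH] u /=; first by rewrite addn0.
by case/andP=> /tree_adj_lead ? /IH; lia.
Qed.

(** The depth of [w] below its spine ancestor. *)
Definition excess (w : word) : nat := size w - lead w.

(** Lower bounds: [lead] changes by at most one along an edge. Upper bound: climb from [u] to the
    spine, follow the spine, descend to [v]. *)
Lemma graph_dist_lead S u v : prefix_closed S -> u \in S -> v \in S ->
  [/\ (lead u <= lead v + graph_dist S u v)%N,
      (lead v <= lead u + graph_dist S u v)%N &
      (graph_dist S u v <=
        maxn (lead u) (lead v) - minn (lead u) (lead v) + excess u + excess v)%N].
Proof.
move=> clS uS vS.
have spine w : w \in S -> path_in S (nseq (lead w) true) w (excess w).
  move=> wS; rewrite /excess -size_drop {2}(lead_split w).
  by apply: path_in_cat; rewrite -?lead_split.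
have along a b : (a <= b)%N -> nseq b true \in S ->
    path_in S (nseq a true) (nseq b true) (b - a).
  move=> ab bS; have e : nseq b true = nseq a true ++ nseq (b - a) true.
    by rewrite cat_nseq /ncons -iterD subnKC.
  by rewrite e -{2}(size_nseq (b - a) true); apply: path_in_cat; rewrite -?e.
have spS w : w \in S -> nseq (lead w) true \in S.
  by move=> wS; apply: (clS _ (drop (lead w) w)); rewrite -lead_split.
have mid : path_in S (nseq (lead u) true) (nseq (lead v) true)
    (maxn (lead u) (lead v) - minn (lead u) (lead v)).
  have [uv|/ltnW vu] := leqP (lead u) (lead v).
    by apply: along => //; exact: spS.
  by apply: path_in_sym; apply: along => //; exact: spS.
have up := path_in_sym _ _ _ _ (spine u uS).
have := path_in_trans _ _ _ _ _ _ (path_in_trans _ _ _ _ _ _ up mid) (spine v vS).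
case/path_in_graph_dist => -[p [<- /path_lead [h1 h2] lp _ _]] h3.
by rewrite lp in h1 h2; split => //; lia.
Qed.

Lemma lead_take i w : (lead w <= i)%N -> lead (take i w) = lead w.
Proof. by elim: w i => [|[] w IH] [|i] //= h; rewrite IH. Qed.

(** The nodes from the spine ancestor of [w] down to [w] are [excess w + 1] distinct elements of [S]
    with the same [lead]: depth is bounded by subtree size. *)
Lemma excess_lt_count S w : uniq S -> prefix_closed S -> w \in S ->
  (excess w < count (fun v => lead v == lead w) S)%N.
Proof.
move=> uS clS wS; rewrite -size_filter.
rewrite -[X in (X <= _)%N](size_iota (lead w)) -(size_map (fun i => take i w)).
have le_w i : i \in iota (lead w) (excess w).+1 -> (lead w <= i <= size w)%N.
  by rewrite mem_iota /excess; have := lead_size w; lia.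
apply: uniq_leq_size.
  rewrite map_inj_in_uniq ?iota_uniq // => i j /le_w /andP[_ iw] /le_w /andP[_ jw].
  by move/(congr1 size); rewrite !size_takel.
move=> v /mapP[i /le_w /andP[li iw] ->]; rewrite mem_filter lead_take // eqxx /=.
by apply: (clS _ (drop i w)); rewrite cat_take_drop.
Qed.

(** * Weights of injective words *)

(** For [L = j] these are the free columns that the model must reject before it accepts [j]. *)
Definition unused (s : seq nat) (L : nat) : seq nat :=
  [seq j <- iota 0 L | j \notin s].

Fixpoint injs (L n : nat) : seq (seq nat) :=
  if n is n'.+1 then [seq rcons s j | s <- injs L n', j <- unused s L]
  else [:: [::]].

Lemma unusedS s L : unused s L.+1 = unused s L ++ (if L \in s then [::] else [:: L]).
Proof. by rewrite /unused -addn1 iotaD filter_cat /= add0n; case: (L \in s). Qed.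

Lemma mem_unused s L j : (j \in unused s L) = (j \notin s) && (j < L)%N.
Proof. by rewrite mem_filter mem_iota add0n. Qed.

Lemma size_unused s L : (L <= size (unused s L) + size s)%N.
Proof.
rewrite size_filter -{1}(size_iota 0 L) -(count_predC (mem s)) addnC leq_add2l.
rewrite -size_filter; apply: uniq_leq_size; first by rewrite filter_uniq ?iota_uniq.
by move=> x; rewrite mem_filter => /andP[].
Qed.

Lemma mem_injs L n s : s \in injs L n -> [/\ size s = n, uniq s & (top s <= L)%N].
Proof.
elim: n s => [|n IH] s /=; first by rewrite inE => /eqP->; rewrite top_nil.
case/allpairsPdep => t [j [/IH[st ut tL]]]; rewrite mem_unused => /andP[jt jL] ->.
by rewrite size_rcons st rcons_uniq jt ut top_rcons geq_max tL jL.
Qed.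

Lemma injs_uniq L n : uniq (injs L n).
Proof.
elim: n => //= n IH; apply: allpairs_uniq_dep => //.
  by move=> s _; rewrite filter_uniq ?iota_uniq.
by move=> [s i] [t j] _ _ /= /rcons_inj [<- <-].
Qed.

Section Weights.
Context {R : realType}.
Variable q : R.
Hypotheses (q0 : 0 <= q) (q1 : q < 1).

(** Row [i] rejects each free column below [s_i] with probability [q] and accepts [s_i] with
    probability [1 - q]. *)
Definition wt (s : seq nat) : R :=
  \prod_(0 <= i < size s)
    ((1 - q) * q ^+ size (unused (take i s) (nth 0%N s i))).

Lemma wt_rcons s j : wt (rcons s j) = wt s * ((1 - q) * q ^+ size (unused s j)).
Proof.
rewrite /wt size_rcons big_nat_recr //=.
rewrite nth_rcons ltnn eqxx -cats1 take_size_cat //; congr (_ * _).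
apply: eq_big_nat => i /andP[_ i_s].
by rewrite takel_cat ?(ltnW i_s) // nth_cat i_s.
Qed.

Lemma wt_ge0 s : 0 <= wt s.
Proof.
by apply: prodr_ge0 => i _; rewrite mulr_ge0 ?exprn_ge0 // subr_ge0 ltW.
Qed.

Lemma sum_injsS L n (F : seq nat -> R) :
  \sum_(s <- injs L n.+1) wt s * F s =
  \sum_(s <- injs L n) wt s *
    \sum_(j <- unused s L) (1 - q) * q ^+ size (unused s j) * F (rcons s j).
Proof.
rewrite big_allpairs_dep; apply: eq_bigr => s _; rewrite big_distrr /=.
by apply: eq_bigr => j _; rewrite wt_rcons !mulrA.
Qed.

(* With [(1 - q) z y = 1 - q z], the process [z ^ top * y ^ nrec] is a martingale:
   [y] cancels the generating function of the geometric overshoot of a record.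
   The last factor accounts for the columns beyond [L]; [L - top s] truncates. *)
Lemma sum_unused_martingale (z y : R) s L : (1 - q) * z * y = 1 - q * z ->
  \sum_(j <- unused s L) (1 - q) * q ^+ size (unused s j) *
     (z ^+ top (rcons s j) * y ^+ nrec (rcons s j)) =
  z ^+ top s * y ^+ nrec s * (1 - q ^+ size (unused s L) * z ^+ (L - top s)).
Proof.
move=> zy; elim: L => [|L IH]; first by rewrite big_nil !expr0; ring.
rewrite unusedS; case: ifP => Ls.
  rewrite cats0 IH; have /eqP -> : (L.+1 - top s == 0)%N by rewrite subn_eq0 lt_top.
  by have /eqP -> : (L - top s == 0)%N by rewrite subn_eq0 ltnW // lt_top.
rewrite big_cat big_seq1 /= IH size_cat /= addn1 top_rcons nrec_rcons.
have [tL|Lt] := leqP (top s) L.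
  rewrite (maxn_idPr _) ?leqW // addn1.
  have -> : L.+1 = (top s + (L - top s).+1)%N by lia.
  rewrite addKn exprD !exprS.
  have -> : q * q ^+ size (unused s L) * (z * z ^+ (L - top s)) =
    (1 - (1 - q) * z * y) * (q ^+ size (unused s L) * z ^+ (L - top s)).
    by rewrite zy; ring.
  by ring.
rewrite (maxn_idPl _) // addn0 exprS.
have /eqP -> : (L.+1 - top s == 0)%N by rewrite subn_eq0.
have /eqP -> : (L - top s == 0)%N by rewrite subn_eq0 ltnW.
by ring.
Qed.

(** Induction on [n]: truncation to columns below [L] only contributes a factor at most 1. *)
Lemma sum_injs_martingale (z y : R) L n : 0 <= z -> 0 <= y ->
  (1 - q) * z * y = 1 - q * z ->
  \sum_(s <- injs L n) wt s * (z ^+ top s * y ^+ nrec s) <= 1.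
Proof.
move=> z0 y0 zy; elim: n => [|n IH].
  by rewrite big_seq1 top_nil /wt /= big_nil !expr0 !mulr1.
apply: le_trans IH; rewrite sum_injsS; apply: ler_sum => s _.
rewrite sum_unused_martingale // ler_wpM2l ?wt_ge0 //.
rewrite ler_piMr ?mulr_ge0 ?exprn_ge0 //.
by rewrite gerBl mulr_ge0 ?exprn_ge0.
Qed.

Lemma sum_injs_le1 L n : \sum_(s <- injs L n) wt s <= 1.
Proof.
have := sum_injs_martingale 1 1 L n ler01 ler01.
under eq_bigr do rewrite !expr1n !mulr1.
by apply; rewrite !mulr1.
Qed.

Lemma sum_injs_ge L n : (n <= L)%N ->
  1 - q ^+ (L - n) / (1 - q) <= \sum_(s <- injs L n) wt s.
Proof.
have p0 : 0 < 1 - q by rewrite subr_gt0.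
elim: n => [|n IH] nL.
  rewrite big_seq1 /wt /= big_nil gerBl divr_ge0 ?exprn_ge0 // ltW //.
have := sum_injsS L n (fun=> 1).
under eq_bigr do rewrite mulr1.
move=> ->; apply: (@le_trans _ _ (\sum_(s <- injs L n) (wt s - wt s * q ^+ (L - n)))).
  rewrite sumrB -mulr_suml; apply: le_trans (lerB (IH (ltnW nL)) _); last first.
    by apply: ler_piMl; rewrite ?exprn_ge0 ?sum_injs_le1.
  have -> : (L - n)%N = (L - n.+1).+1 by lia.
  have h : 0 <= q ^+ (L - n.+1) by rewrite exprn_ge0.
  rewrite -addrA lerD2l -opprD lerN2 exprS.
  rewrite -[X in _ + X](mulfK (lt0r_neq0 p0)) -mulrDl ler_pM2r ?invr_gt0 //.
  set a := q ^+ _ in h *.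
  (* The induction closes because [q + q * (1 - q) <= 1], that is [0 <= (1 - q) ^+ 2]. *)
  have : 0 <= (1 - q) ^+ 2 * a by rewrite mulr_ge0 ?sqr_ge0.
  have e : a - (q * a + q * a * (1 - q)) = (1 - q) ^+ 2 * a by ring.
  by rewrite -e subr_ge0.
rewrite big_seq [leRHS]big_seq; apply: ler_sum => s /mem_injs[ss us sL].
have := sum_unused_martingale 1 1 s L; rewrite !expr1n !mulr1.
under eq_bigr do rewrite !expr1n mulr1.
move=> -> //; rewrite mul1r -{1}(mulr1 (wt s)) -mulrBr ler_wpM2l ?wt_ge0 //.
rewrite lerD2l lerN2; apply: ler_wiXn2l => //; first exact: ltW.
by rewrite leq_subLR addnC -ss size_unused.
Qed.

(** Take [z = (1 + u)^-1] and [y = 1 + u / (1 - q)], which satisfy the martingale relation, and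
    bound both from below by exponentials through [1 + x <= expR x]. *)
Lemma sum_injs_expR (u : R) L n : - (1 - q) < u ->
  \sum_(s <- injs L n)
    wt s * expR (u * ((nrec s)%:R / (1 - q + u) - (top s)%:R)) <= 1.
Proof.
move=> pu; have p0 : 0 < 1 - q by rewrite subr_gt0.
have pu0 : 0 < 1 - q + u by lra.
have u1 : 0 < 1 + u by move: q0; lra.
have yE : 1 + u / (1 - q) = (1 - q + u) / (1 - q) by field; lra.
apply: le_trans (sum_injs_martingale (1 + u)^-1 (1 + u / (1 - q)) L n _ _ _).
- apply: ler_sum => s _; rewrite ler_wpM2l ?wt_ge0 // mulrBr expRD mulrC.
  rewrite expRN expRM_natr -exprVn mulrCA expRM_natl.
  have h1 : (expR u)^-1 <= (1 + u)^-1.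
    by rewrite lef_pV2 ?posrE ?expR_gt0 // expR_ge1Dx.
  have h2 : expR (u / (1 - q + u)) <= 1 + u / (1 - q).
    rewrite yE -(invrK (expR _)) -expRN -[leRHS]invrK invf_div.
    rewrite lef_pV2 ?posrE ?expR_gt0 ?divr_gt0 //.
    have -> : (1 - q) / (1 - q + u) = 1 + - (u / (1 - q + u)) by field; lra.
    exact: expR_ge1Dx.
  have g1 : 0 <= (expR u)^-1 by rewrite invr_ge0 expR_ge0.
  have g2 := expR_ge0 (u / (1 - q + u)).
  by apply: ler_pM; rewrite ?exprn_ge0 //; apply: lerXn2r => //;
    rewrite nnegrE; [exact: le_trans h1|exact: le_trans h2].
- by rewrite invr_ge0 ltW.
- by rewrite yE divr_ge0 // ltW.
- by field; lra.
Qed.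

(* Markov's inequality for [sum_injs_expR], with [u = e / 2] and [u = - e / 2]. *)
Lemma sum_injs_nrec (e : R) n L : 0 < e -> e <= 1 - q ->
  (L%:R <= (1 + e / 8) * n%:R :> R) ->
  \sum_(s <- injs L n | ~~ (`|(nrec s)%:R - (1 - q) * n%:R| <= e * n%:R)) wt s
  <= 2 * expR (- (e ^+ 2 / 16)) ^+ n.
Proof.
move=> e0 ep Ln; have [p pE] : exists p : R, p = 1 - q by exists (1 - q).
have p1 : p <= 1 by rewrite pE gerBl.
rewrite -pE in ep *.
set X := expR (- (e ^+ 2 / 16) * n%:R).
have X0 : 0 < X by apply: expR_gt0.
have -> : expR (- (e ^+ 2 / 16)) ^+ n = X by rewrite -expRM_natr.
pose f (u : R) (s : seq nat) := expR (u * ((nrec s)%:R / (p + u) - (top s)%:R)).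
(* Both sums are at most 1, so it suffices that on every bad word one of the two exponentials is at
   least [X^-1]. *)
apply: (@le_trans _ _ (X * \sum_(s <- injs L n) wt s * f (e / 2) s +
                       X * \sum_(s <- injs L n) wt s * f (- (e / 2)) s)); last first.
  by rewrite mulr_natl [leRHS]mulr2n; apply: lerD; apply: (ler_piMr (ltW X0));
    rewrite /f pE; apply: sum_injs_expR; rewrite -pE; lra.
rewrite -mulrDr -big_split big_distrr /= big_mkcond /= big_seq [leRHS]big_seq.
apply: ler_sum => s /mem_injs [ss us sL].
rewrite -mulrDr mulrCA; set c := X * _.
have f0 u : 0 < f u s by apply: expR_gt0.
have c0 : 0 <= c by rewrite mulr_ge0 ?addr_ge0 // ltW.
case: ifP => [bad|_]; last by rewrite mulr_ge0 ?wt_ge0.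
rewrite ler_peMr ?wt_ge0 //.
have n0 : 0 <= n%:R :> R by [].
have nt : n%:R <= (top s)%:R :> R by rewrite ler_nat -ss size_le_top.
have tL : (top s)%:R <= L%:R :> R by rewrite ler_nat.
have key u : e ^+ 2 / 16 * n%:R <= u * ((nrec s)%:R / (p + u) - (top s)%:R) ->
    1 <= X * f u s.
  by move=> h; rewrite /X /f -expRD -{1}expR0 ler_expR mulNr [leRHS]addrC subr_ge0.
move: bad; rewrite ler_distl negb_and -!ltNge => /orP[lo|hi].
  (* Too few records: here [n <= top s], from distinctness, is used. *)
  apply: le_trans (key (- (e / 2)) _) _; last first.
    by rewrite ler_pM2l // lerDr ltW.
  have hr : (nrec s)%:R / (p - e / 2) <= (1 - e / 2) * n%:R.
    rewrite ler_pdivrMr; last by lra.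
    apply: le_trans (ltW lo) _; rewrite -mulrBl mulrAC ler_wpM2r //.
    by nra.
  rewrite mulNr -mulrN; set r := _ / _ in hr *.
  have h : e / 2 * (e / 2 * n%:R) <= e / 2 * - (r - (top s)%:R).
    by rewrite ler_pM2l; lra.
  apply: le_trans h.
  by nra.
(* Too many records: here [top s <= L <= (1 + e / 8) n] is used, and the exponent [e ^+ 2 / 16]
   arises as [e / 2 * (e / 4 - e / 8)]. *)
apply: le_trans (key (e / 2) _) _; last first.
  by rewrite ler_pM2l // lerDl ltW.
have hr : (1 + e / 4) * n%:R <= (nrec s)%:R / (p + e / 2).
  rewrite ler_pdivlMr; last by lra.
  apply: le_trans (ltW hi); rewrite -mulrDl mulrAC ler_wpM2r //.
  by nra.
have : e ^+ 2 / 16 * n%:R = e / 2 * ((1 + e / 4) * n%:R - (1 + e / 8) * n%:R) by field.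
move=> ->; rewrite ler_pM2l; last by lra.
by lra.
Qed.


(** The slack [n %/ m] is large enough to make the weight beyond [L] exponentially small, and with
    [8 / e <= m] small enough for the record bound. *)
Lemma sum_injs_typical (e : R) m : 0 < e -> e <= 1 - q -> 8 / e <= m%:R ->
  exists C rho : R, [/\ 0 <= C, 0 <= rho, rho < 1 & forall n,
    1 - C * rho ^+ n <=
    \sum_(s <- injs (n + n %/ m) n |
            `|(nrec s)%:R - (1 - q) * n%:R| <= e * n%:R) wt s].
Proof.
move=> e0 ep em; have [p pE] : exists p : R, p = 1 - q by exists (1 - q).
have p0 : 0 < p by rewrite pE subr_gt0.
have m0 : 0 < m%:R :> R by apply: lt_le_trans em; rewrite divr_gt0.
have m0' : (0 < m)%N by rewrite ltr0n in m0.
pose rho1 : R := expR (- (p / m%:R)); pose rho2 := expR (- (e ^+ 2 / 16)).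
have rho10 : 0 <= rho1 by apply: expR_ge0.
have rho20 : 0 <= rho2 by apply: expR_ge0.
have rho0 : 0 <= Num.max rho1 rho2 by rewrite le_max rho10.
(* The factor [expR p] pays for the rounding in [n %/ m]; the 2 comes from the two-sided record
   bound. *)
exists (expR p / p + 2), (Num.max rho1 rho2); split => //.
- by rewrite addr_ge0 ?divr_ge0 ?expR_ge0 ?(ltW p0).
- have lt1 (x : R) : 0 < x -> expR (- x) < 1.
    by move=> x0; rewrite -expR0 ltr_expR oppr_lt0.
  by rewrite gt_max !lt1 ?divr_gt0 ?exprn_gt0.
move=> n; set L := (n + n %/ m)%N.
have Ln : (L%:R <= (1 + e / 8) * n%:R :> R).
  rewrite /L natrD mulrDl mul1r lerD2l.
  have h : (n %/ m)%:R * m%:R <= n%:R :> R by rewrite -natrM ler_nat leq_trunc_div.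
  have h2 : (n %/ m)%:R * (8 / e) <= n%:R.
    by apply: le_trans h; rewrite ler_wpM2l.
  rewrite mulrA ler_pdivrMr // in h2.
  by rewrite mulrAC ler_pdivlMr // mulrC [e * _]mulrC mulrC.
have h1 := sum_injs_nrec e n L e0 ep Ln.
have h2 := sum_injs_ge L n (leq_addr _ _).
rewrite (bigID (fun s => `|(nrec s)%:R - (1 - q) * n%:R| <= e * n%:R)) /= in h2.
have b1 : q ^+ (L - n) / (1 - q) <= expR p / p * Num.max rho1 rho2 ^+ n.
  rewrite -pE mulrAC ler_pM2r ?invr_gt0 // /L addKn.
  apply: (@le_trans _ _ (expR p * rho1 ^+ n)); last first.
    rewrite ler_pM2l ?expR_gt0 //; apply: lerXn2r; rewrite ?nnegrE //.
    by rewrite le_max lexx.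
  apply: (@le_trans _ _ (expR (- p) ^+ (n %/ m))).
    apply: lerXn2r; rewrite ?nnegrE ?expR_ge0 //.
    have -> : q = 1 + - p by rewrite pE; ring.
    exact: expR_ge1Dx.
  rewrite /rho1 -!expRM_natr -expRD ler_expR.
  have : n%:R <= ((n %/ m)%:R + 1) * m%:R :> R.
    by rewrite natr1 -natrM ler_nat ltnW // ltn_ceil.
  rewrite -ler_pdivrMr // => h.
  have := ler_wpM2l (ltW p0) h; rewrite mulrA [p * _ / _]mulrAC.
  by lra.
have b2 : 2 * rho2 ^+ n <= 2 * Num.max rho1 rho2 ^+ n.
  rewrite ler_pM2l //; apply: lerXn2r; rewrite ?nnegrE //.
  by rewrite le_max lexx orbT.
rewrite -/rho2 in h1; rewrite mulrDl.
by lra.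
Qed.

End Weights.

(** * Typical behaviour of the infinite Bernoulli model *)

Lemma first_free_eq (b : nat -> bool) (u : seq nat) j : b j -> j \notin u ->
  (forall i, i \in unused u j -> ~~ b i) -> first_free b u = j.
Proof.
move=> bj ju lt_j; rewrite /first_free; case: pselect => [ex|[]]; last first.
  by exists j; rewrite ju.
case: ex_minnP => k /andP[ku bk] kmin; apply/eqP; rewrite eqn_leq kmin ?ju //=.
by rewrite leqNgt; apply: contraL bk => kj; apply: lt_j; rewrite mem_unused ku.
Qed.

(* The entries of the Bernoulli matrix read by the model when it outputs [s]. *)
Definition cyl_idx (s : seq nat) : seq (nat * nat) :=
  [seq (i, j) | i <- iota 0 (size s),
                j <- rcons (unused (take i s) (nth 0%N s i)) (nth 0%N s i)].

Lemma cyl_idx_uniq s : uniq (cyl_idx s).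
Proof.
apply: allpairs_uniq_dep; first exact: iota_uniq.
  by move=> i _; rewrite rcons_uniq mem_unused ltnn andbF filter_uniq ?iota_uniq.
by move=> [i j] [i' j'] _ _ /= [-> ->].
Qed.

Section Probability.
Context {R : realType} {d : measure_display} {T : measurableType d}.
Variables (P : probability T R) (q : R) (B : nat -> nat -> T -> bool).
Hypotheses (q0 : 0 <= q) (q1 : q < 1) (iidB : bernoulli_iid_family P q B).

Local Notation I w := (Iseq (fun i j => B i j w)).

Definition cyl (s : seq nat) : set T :=
  \bigcap_(k in [set` cyl_idx s]) [set w | B k.1 k.2 w = (k.2 == nth 0%N s k.1)].

Lemma measurable_cell i j (v : bool) : measurable [set w | B i j w = v].
Proof.
have [mB _ _] := iidB; case: v; first exact: mB.
rewrite (_ : mkset _ = ~` [set w | B i j w]); first exact/measurableC/mB.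
by apply/seteqP; split => w /=; [move=> ->|move=> /negP/negbTE].
Qed.

Lemma probability_cell i j (v : bool) :
  P [set w | B i j w = v] = (if v then 1 - q else q)%:E.
Proof.
have [mB PB _] := iidB; case: v; first exact: PB.
rewrite (_ : mkset _ = ~` [set w | B i j w]).
  by rewrite probability_setC // PB -EFinB; congr EFin; ring.
by apply/seteqP; split => w /=; [move=> ->|move=> /negP/negbTE].
Qed.

Lemma measurable_cyl s : measurable (cyl s).
Proof.
by apply: fin_bigcap_measurable => [|k _]; [exact: finite_seq|exact: measurable_cell].
Qed.

Lemma probability_cyl s : P (cyl s) = (wt q s)%:E.
Proof.
have [_ _ indB] := iidB.
rewrite /cyl (indB _ (fun k => k.2 == nth 0%N s k.1)) ?cyl_idx_uniq //.
under eq_bigr do rewrite probability_cell.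
rewrite prodEFin big_allpairs_dep /wt /index_iota subn0; congr EFin.
apply: eq_bigr => i _; rewrite -cats1 big_cat big_seq1 /= eqxx mulrC; congr (_ * _).
rewrite big_seq (eq_bigr (fun=> q)).
  by rewrite -big_seq big_const_seq count_predT iter_mulr_1.
by move=> j; rewrite mem_unused => /andP[_ jl]; rewrite (ltn_eqF jl).
Qed.

(** Row by row, the free columns before [s_i] fail and [s_i], which is still free, succeeds. *)
Lemma Iseq_cyl s w : uniq s -> cyl s w -> I w (size s) = s.
Proof.
move=> us csw.
have csw' i j : (i < size s)%N ->
    j \in rcons (unused (take i s) (nth 0%N s i)) (nth 0%N s i) ->
    B i j w = (j == nth 0%N s i).
  move=> i_s js; apply: (csw (i, j)) => /=; apply/allpairsPdep.
  by exists i, j; rewrite mem_iota.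
suff H i : (i <= size s)%N -> I w i = take i s by rewrite H // take_size.
elim: i => [|i IH] i_s; first by rewrite take0.
rewrite /= IH ?(ltnW i_s) // (take_nth 0%N) //; congr rcons.
apply: first_free_eq.
- by rewrite csw' ?eqxx // mem_rcons inE eqxx.
- have := us; rewrite -{1}(cat_take_drop i s) (drop_nth 0%N) // cat_uniq.
  by rewrite /= negb_or => /and3P[_ /andP[]].
- move=> j js; rewrite csw' //; last by rewrite mem_rcons inE js orbT.
  by move: js; rewrite mem_unused => /andP[_ jl]; rewrite (ltn_eqF jl).
Qed.

Lemma measurable_bigcyl l : measurable (\big[setU/set0]_(s <- l) cyl s).
Proof. by apply: bigsetU_measurable => s _; exact: measurable_cyl. Qed.

(** A cylinder determines the first [n] outputs of the model, so cylinders of distinct words are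
    disjoint. *)
Lemma probability_bigcyl n l : uniq l ->
  (forall s, s \in l -> size s = n /\ uniq s) ->
  P (\big[setU/set0]_(s <- l) cyl s) = (\sum_(s <- l) wt q s)%:E.
Proof.
elim: l => [|s l IH] /= => [_ _|/andP[sl ul] hl]; first by rewrite !big_nil measure0.
have hl' t : t \in l -> size t = n /\ uniq t.
  by move=> tl; apply: hl; rewrite inE tl orbT.
have dis : cyl s `&` \big[setU/set0]_(t <- l) cyl t = set0.
  rewrite -subset0 => w [sw]; rewrite -bigcup_seq => -[t /= tl tw].
  have [ss us] := hl s (mem_head _ _); have [ts ut] := hl' t tl.
  move: sl; rewrite -(Iseq_cyl _ _ us sw) ss -ts (Iseq_cyl _ _ ut tw).
  by rewrite tl.
rewrite !big_cons measureU //; [|exact: measurable_cyl|exact: measurable_bigcyl].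
by rewrite EFinD -probability_cyl -IH.
Qed.

(** Borel-Cantelli: the complement [F n] of the union of the good cylinders has geometrically small
    probability. *)
Lemma Iseq_typical (e : R) : 0 < e -> e <= 1 - q ->
  {ae P, forall w, \forall n \near \oo,
    [/\ uniq (I w n), (top (I w n))%:R <= (1 + e) * n%:R &
        `|(nrec (I w n))%:R - (1 - q) * n%:R| <= e * n%:R]}.
Proof.
move=> e0 ep; pose m := (Num.truncn (8 / e)).+1.
have em : 8 / e <= m%:R by rewrite ltW // truncnS_gt.
have [C [rho [C0 rho0 rho1 Hsum]]] := sum_injs_typical _ q0 q1 e m e0 ep em.
pose good n := [seq s <- injs (n + n %/ m) n |
                 `|(nrec s)%:R - (1 - q) * n%:R| <= e * n%:R].
have goodP n s : s \in good n -> [/\ size s = n, uniq s,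
    (top s <= n + n %/ m)%N & `|(nrec s)%:R - (1 - q) * n%:R| <= e * n%:R].
  by rewrite mem_filter => /andP[? /mem_injs[]].
pose F n := ~` (\big[setU/set0]_(s <- good n) cyl s).
have mF n : measurable (F n) by exact/measurableC/measurable_bigcyl.
have PF n : (P (F n) <= (C * rho ^+ n)%:E)%E.
  rewrite probability_setC ?(probability_bigcyl n); last exact: measurable_bigcyl.
  - by rewrite -EFinB lee_fin big_filter; have := Hsum n; lra.
  - by rewrite filter_uniq // injs_uniq.
  - by move=> s /goodP[].
have sumF : (\sum_(n <oo) P (F n) < +oo)%E.
  apply: (@le_lt_trans _ _ (C / (1 - rho))%:E); last exact: ltry.
  apply: lime_le; first by apply: is_cvg_nneseries.
  apply: nearW => N; apply: (@le_trans _ _ (\sum_(0 <= n < N) (C * rho ^+ n)%:E)%E).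
    by apply: lee_sum => n _; exact: PF.
  rewrite sumEFin lee_fin.
  have -> : \sum_(0 <= n < N) C * rho ^+ n = C * (1 - rho ^+ N) / (1 - rho).
    have r1 : 1 - rho != 0 by rewrite subr_eq0 eq_sym lt_eqF.
    elim: N => [|N IH]; first by rewrite big_nil expr0 subrr mulr0 mul0r.
    by rewrite big_nat_recr //= IH exprS; field.
  rewrite ler_pM2r ?invr_gt0 ?subr_gt0 // ler_piMr // gerBl exprn_ge0 //.
exists (lim_sup_set F); split.
- by apply: bigcap_measurableType => k _; apply: bigcup_measurable.
- exact: lim_sup_set_cvg0.
move=> w /= nw k _; apply: contrapT => nF; apply: nw; exists k => // n /= kn.
have : ~ F n w by move=> Fn; apply: nF; exists n.
move/contrapT; rewrite -bigcup_seq => -[s /= /goodP[ss us st sr] sw].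
have <- : s = I w n by rewrite -ss Iseq_cyl.
split => //.
have m0 : 0 < m%:R :> R by [].
apply: (@le_trans _ _ (n + n %/ m)%:R); first by rewrite ler_nat.
rewrite natrD mulrDl mul1r lerD2l.
have h : (n %/ m)%:R * m%:R <= n%:R :> R by rewrite -natrM ler_nat leq_trunc_div.
have h2 : (n %/ m)%:R * (8 / e) <= n%:R by apply: le_trans h; rewrite ler_wpM2l.
rewrite mulrA ler_pdivrMr // in h2.
rewrite mulrC; apply: le_trans h2.
by rewrite ler_peMr // ler1n.
Qed.

End Probability.

(** * Coupling the tree with the unit interval *)

Section Coupling.
Context {R : realType}.

(* [lebesgue_measure] lives on [measurableTypeR R], whose structure is not
   convertible to the canonical measurable structure of [R]. *)
Definition lebR : set R -> \bar R := @lebesgue_measure R.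
Let lebR0 : lebR set0 = 0%E. Proof. exact: measure0. Qed.
Let lebR_ge0 A : (0 <= lebR A)%E. Proof. exact: measure_ge0. Qed.
Let lebR_sigma_additive : semi_sigma_additive lebR.
Proof. exact: (@measure_semi_sigma_additive _ _ _ (@lebesgue_measure R)). Qed.
HB.instance Definition _ :=
  isMeasure.Build _ R R lebR lebR0 lebR_ge0 lebR_sigma_additive.

(** The product of the point mass at [w] and Lebesgue measure on [D], built as a pushforward along
    [x |-> (w, x)]. *)
Lemma slice_measure (w : word) (D : set R) : measurable D ->
  exists M : {measure set (word * R)%type -> \bar R},
    forall A, M A = lebR ([set x | A (w, x)] `&` D).
Proof.
move=> mD; pose mr : {measure set R -> \bar R} := mrestr lebR mD.
have mw : measurable_fun [set: R] (pair w : R -> (word * R)%type).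
  exact: pair1_measurable.
unshelve eexists.
  by refine (pushforward mr (pair w) : {measure set (word * R)%type -> \bar R});
     exact: mw.
by [].
Qed.

(** Half-open, so that the first [n] slices are disjoint. *)
Definition slice (n j : nat) : set R := `]j%:R / n%:R, j.+1%:R / n%:R]%classic.

Lemma slices_measure (ws : seq word) (n : nat) :
  exists M : {measure set (word * R)%type -> \bar R},
    forall A, M A = (\sum_(j < n) lebR ([set x | A (nth [::] ws j, x)] `&` slice n j))%E.
Proof.
have mD j : measurable (slice n j) by exact: measurable_itv.
pose m j := projT1 (cid (slice_measure (nth [::] ws j) _ (mD j))).
exists (msum m n) => A; apply: eq_bigr => j _.
by rewrite /m; case: cid.
Qed.

Lemma lebR_slice n j : (0 < n)%N -> lebR (slice n j) = (n%:R^-1)%:E.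
Proof.
move=> n0; have n0' : 0 < n%:R :> R by rewrite ltr0n.
rewrite /lebR lebesgue_measure_itv /= lte_fin ltr_pM2r ?invr_gt0 // ltr_nat ltnS leqnn.
by rewrite -EFinB -mulrBl -natrB // subSnn mul1r.
Qed.

Lemma sum_lebR_slice n k (B : set R) : (0 < n)%N -> measurable B ->
  (\sum_(j < k) lebR (B `&` slice n j))%E = lebR (B `&` `]0, k%:R / n%:R]).
Proof.
move=> n0 mB; have n0' : 0 < n%:R :> R by rewrite ltr0n.
elim: k => [|k IH].
  by rewrite big_ord0 mul0r set_itvE setI0 measure0.
rewrite big_ord_recr /= IH -measureU.
- rewrite -setIUr; congr (lebR (_ `&` _)); apply/seteqP.
  have h1 : k%:R / n%:R <= k.+1%:R / n%:R :> R by rewrite ler_pM2r ?invr_gt0 // ler_nat.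
  have h0 : 0 <= k%:R / n%:R :> R by rewrite divr_ge0.
  split => x; rewrite /slice /= !in_itv /=.
    by case=> /andP[? ?]; apply/andP; split; lra.
  by case/andP => x0 x1; case: (lerP x (k%:R / n%:R)) => xk; [left|right]; rewrite ?x0.
- by apply: measurableI => //; exact: measurable_itv.
- by apply: measurableI => //; exact: measurable_itv.
- rewrite -subset0 => x [[_ +] [_]]; rewrite /slice /= !in_itv /= => /andP[_ ?] /andP[? _].
  by lra.
Qed.

(** The slices miss only the point 0 of the unit interval, a null set. *)
Lemma sum_lebR_slices n (B : set R) : (0 < n)%N -> measurable B ->
  (\sum_(j < n) lebR (B `&` slice n j))%E = leb01 B.
Proof.
move=> n0 mB; rewrite sum_lebR_slice // divff ?pnatr_eq0 -?lt0n //.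
apply/eqP; rewrite eq_le; apply/andP; split.
  apply: le_measure; rewrite ?inE; do ?by apply: measurableI => //; exact: measurable_itv.
  by move=> x [Bx]; rewrite /= !in_itv /= => /andP[/ltW -> ->].
rewrite -[leRHS]adde0 -[X in (_ + X)%E](lebesgue_measure_set1 (0 : R)).
apply: (@le_trans _ _ (lebR ((B `&` `]0, 1]) `|` [set 0]))).
  apply: le_measure; rewrite ?inE; do ?by apply: measurableI => //; exact: measurable_itv.
    apply: measurableU; last exact: measurable_set1.
    by apply: measurableI => //; exact: measurable_itv.
  move=> x [Bx]; rewrite /= !in_itv /= => /andP[x0 ->]; rewrite andbT.
  by move: x0; rewrite le_eqVlt => /orP[/eqP<-|]; [right|left].
apply: measureU2; last exact: measurable_set1.
by apply: measurableI => //; exact: measurable_itv.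
Qed.

End Coupling.

(** In the list sorted by [lead], the nodes of one spine index form a block whose end positions are
    the cumulative counts. *)
Lemma sort_lead (S : seq word) : exists ws : seq word, perm_eq ws S /\
  forall j, (j < size S)%N ->
    (count (fun w => lead w < lead (nth [::] ws j))%N S <= j <
     count (fun w => lead w < (lead (nth [::] ws j)).+1)%N S)%N.
Proof.
pose ws := sort (relpre lead leq) S.
have pws : perm_eq ws S by rewrite perm_sort.
exists ws; split => // j; rewrite -(perm_size pws) => js.
rewrite -!(permP pws); set k := lead _.
have so : sorted <=%O (map lead ws).
  rewrite sorted_map; apply: sort_sorted => u v; exact: leq_total.
have nk : nth 0%N (map lead ws) j = k by rewrite (nth_map [::]).
apply/andP; split.
  rewrite leqNgt; apply/negP => h.
  have := @nth_count_lt _ _ k 0%N (map lead ws) j so; rewrite nk ltxx count_map.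
  by move=> /(_ h).
rewrite ltnNge; apply/negP => h.
have := @nth_count_gt _ _ k 0%N (map lead ws) j so.
by rewrite nk ltxx count_map size_map js andbT => /(_ h).
Qed.

(** * From linear cumulative counts along the spine to a bound on the GHP distance *)

Section TreeDistance.
Context {R : realType}.
Variables (p c : R) (S : seq word).
Hypotheses (p0 : 0 < p) (uS : uniq S) (clS : prefix_closed S) (S0 : (0 < size S)%N).

Local Notation N k := (count (fun w => lead w < k)%N S).
Local Notation n := (size S).

Hypothesis countS : forall w k, w \in S -> (k <= (lead w).+1)%N ->
  `|(N k)%:R - k%:R / p| <= c.

Let c0 : 0 <= c.
Proof.
case: S S0 countS => // w ? _ /(_ w 0%N (mem_head _ _) (leq0n _)).
exact: le_trans.
Qed.

Let n0 : 0 < n%:R :> R. Proof. by rewrite ltr0n. Qed.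

(** [a] bounds the gap between a rescaled spine index and the points of the slice of its node; [b]
    bounds the rescaled depth below the spine. *)
Let a : R := (c + p^-1 + 1) / n%:R.
Let b : R := (2 * c + p^-1) / (p * n%:R).

(** The depth is less than the increment of the counts at [lead w], which is at most
    [2 * c + p^-1]. *)
Lemma excess_le w : w \in S -> (excess w)%:R / (p * n%:R) <= b.
Proof.
move=> wS; rewrite ler_pM2r ?invr_gt0 ?mulr_gt0 //.
have h0 := countS w (lead w) wS (leqnSn _).
have h1 := countS w (lead w).+1 wS (leqnn _).
have ec : ((excess w) + N (lead w) <= N (lead w).+1)%N.
  have -> : (N (lead w).+1 = count (fun v => lead v == lead w) S + N (lead w))%N.
    by elim: (S) => //= v t ->; rewrite ltnS; case: (ltngtP (lead v) (lead w)) => _; lia.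
  by rewrite leq_add2r ltnW // excess_lt_count.
rewrite -(ler_nat R) natrD in ec.
move: h0 h1; rewrite !ler_norml -natr1 mulrDl mul1r => /andP[? ?] /andP[? ?].
by lra.
Qed.

(** Replacing [x] and [y] by the rescaled spine indices costs [2 * a], leaving the spine at both
    ends costs [2 * b]. *)
Lemma distortion_le u v x y : u \in S -> v \in S ->
  `|(lead u)%:R / (p * n%:R) - x| <= a -> `|(lead v)%:R / (p * n%:R) - y| <= a ->
  `|(graph_dist S u v)%:R / (p * n%:R) - `|x - y| | <= 2 * (a + b).
Proof.
move=> uS' vS; have [h1 h2 h3] := graph_dist_lead S u v clS uS' vS.
have bu := excess_le u uS'; have bv := excess_le v vS.
have pn : 0 < (p * n%:R)^-1 by rewrite invr_gt0 mulr_gt0.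
move: h1; rewrite -(ler_nat R) natrD -(ler_pM2r pn) mulrDl => h1.
move: h2; rewrite -(ler_nat R) natrD -(ler_pM2r pn) mulrDl => h2.
have {}h3 : (graph_dist S u v)%:R / (p * n%:R) <=
    `|(lead u)%:R / (p * n%:R) - (lead v)%:R / (p * n%:R)| + b + b.
  apply: (@le_trans _ _ (`|(lead u)%:R / (p * n%:R) - (lead v)%:R / (p * n%:R)|
    + (excess u)%:R / (p * n%:R) + (excess v)%:R / (p * n%:R))); last by lra.
  rewrite -mulrBl normrM (gtr0_norm pn) -!mulrDl ler_pM2r //.
  move: h3; rewrite -(ler_nat R) !natrD => h3; apply: le_trans h3 _.
  rewrite !lerD2r; case: (leqP (lead u) (lead v)) => [uv|/ltnW vu].
    by rewrite distrC natrB // ler_norm.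
  by rewrite natrB // ler_norm.
move: h1 h2 h3; set X := (lead u)%:R / _; set Y := (lead v)%:R / _; set G := _ / _.
rewrite !ler_norml => h1 h2 + /andP[? ?] /andP[? ?].
by case: (ger0P (X - Y)) => ?; case: (ger0P (x - y)) => ? ?; apply/andP; split; lra.
Qed.

(** The correspondence pairs a node with the points within [a] of its rescaled spine index; the
    slice coupling is supported on it. *)
Lemma dGHP_tree :
  0 <= dGHP [set w | w \in S] (fun u v => (graph_dist S u v)%:R / (p * n%:R))
         (@unif_nodes R S) (`[0, 1] : set R) (fun x y : R => `|x - y|) (@leb01 R)
    <= a + b.
Proof.
have a0 : 0 < a by rewrite divr_gt0 // ltr_wpDl // addr_ge0 // invr_ge0 ltW.
have b0 : 0 <= b.
  by rewrite divr_ge0 ?addr_ge0 ?mulr_ge0 ?invr_ge0 // ltW.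
have [ws [pws wsP]] := sort_lead S.
have szw := perm_size pws.
have wS j : (j < n)%N -> nth [::] ws j \in S.
  by move=> jn; rewrite -(perm_mem pws) mem_nth // szw.
(* For such [x], both [j] and [x * n] are sandwiched through the counts at [lead] and [lead + 1],
   each within [c] of its linear value. *)
have close j (x : R) : (j < n)%N -> j%:R / n%:R <= x <= j.+1%:R / n%:R ->
    `|(lead (nth [::] ws j))%:R / (p * n%:R) - x| <= a.
  move=> jn /andP[]; rewrite ler_pdivrMr // ler_pdivlMr // => x1 x2.
  have /andP[h1 h2] := wsP j jn.
  have g1 := countS _ (lead (nth [::] ws j)) (wS j jn) (leqnSn _).
  have g2 := countS _ (lead (nth [::] ws j)).+1 (wS j jn) (leqnn _).
  rewrite -(ler_nat R) in h1; rewrite -(ler_nat R) in h2.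
  move: g1 g2; rewrite !ler_norml -[in X in _ -> X -> _]natr1 mulrDl mul1r.
  set t := _%:R / p => /andP[? ?] /andP[? ?].
  have -> : (lead (nth [::] ws j))%:R / (p * n%:R) - x = (t - x * n%:R) / n%:R.
    by rewrite invfM mulrA mulrBl mulfK ?lt0r_neq0.
  rewrite -mulNr ler_pM2r ?invr_gt0 // ler_pM2r ?invr_gt0 //.
  rewrite -natr1 in h2 x2; have := ltW p0; rewrite -invr_ge0 => ?.
  by apply/andP; split; lra.
have slice01 j (x : R) : (j < n)%N -> j%:R / n%:R <= x <= j.+1%:R / n%:R -> 0 <= x <= 1.
  move=> jn /andP[x1 x2]; rewrite (le_trans _ x1) ?divr_ge0 //=.
  by apply: le_trans x2 _; rewrite ler_pdivrMr // mul1r ler_nat.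
pose C : set (word * R)%type := [set z | [/\ z.1 \in S, 0 <= z.2 <= 1 &
  `|(lead z.1)%:R / (p * n%:R) - z.2| <= a]].
have [M ME] := slices_measure (R := R) ws n.
rewrite /dGHP; set Q := (X in inf X); have key : Q (a + b).
  split; first by rewrite ltr_pwDl.
  exists C, M; split.
  - split.
    + rewrite (_ : C = \bigcup_(w in [set` S]) ([set w] `*` (`[0, 1]%classic `&`
         `[(lead w)%:R / (p * n%:R) - a, (lead w)%:R / (p * n%:R) + a]%classic))).
        apply: fin_bigcup_measurable; first exact: finite_seq.
        move=> w _; apply: measurableX => //; apply: measurableI; exact: measurable_itv.
      apply/seteqP; split => -[w x] /=.
        case=> /= wS' x01; rewrite distrC ler_distl => xa.
        by exists w => //; split => //; split; rewrite /= in_itv.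
      case=> v /= vS [/= -> []]; rewrite !in_itv /= => x01 xa; split => //=.
      by rewrite distrC ler_distl.
    + by move=> [w x] [/= wS' x01 _]; split => //=; rewrite in_itv.
    + apply/seteqP; split => [w [[v x] [/= vS _ _] <-]//|w /= wS'].
      have jn : (index w ws < n)%N by rewrite -szw index_mem (perm_mem pws).
      have wj : nth [::] ws (index w ws) = w.
        by rewrite nth_index // (perm_mem pws).
      have jx : (index w ws)%:R / n%:R <= ((index w ws)%:R / n%:R : R)
          <= (index w ws).+1%:R / n%:R.
        by rewrite lexx /= ler_pM2r ?invr_gt0 // ler_nat.
      exists (w, (index w ws)%:R / n%:R) => //; split => //=; first exact: slice01 jx.
      by have := close _ _ jn jx; rewrite wj.
    + apply/seteqP; split => [x [[v y] [/= _ y01 _] <-]|x /=].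
        by rewrite /= in_itv.
      rewrite in_itv /= => x01; have [x0 x1] := andP x01.
      have [j jn jx] : exists2 j, (j < n)%N & j%:R / n%:R <= x <= j.+1%:R / n%:R.
        have xn0 : 0 <= x * n%:R by rewrite mulr_ge0.
        have [tn|nt] := ltnP (Num.truncn (x * n%:R)) n.
          exists (Num.truncn (x * n%:R)) => //.
          rewrite ler_pdivrMr // ler_pdivlMr //.
          by have /andP[-> /ltW ->] := truncn_itv xn0.
        (* Here [x = 1], the right end of the last slice. *)
        exists n.-1; first by rewrite prednK.
        rewrite prednK // divff ?lt0r_neq0 // x1 andbT ler_pdivrMr //.
        apply: (@le_trans _ _ (Num.truncn (x * n%:R))%:R).
          by rewrite ler_nat (leq_trans (leq_pred _)).
        by have /andP[] := truncn_itv xn0.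
      by exists (nth [::] ws j, x) => //; split => //=; [exact: wS|exact: close].
  - by move=> [u x] [v y] [/= uS' _ ux] [/= vS _ vy]; apply: distortion_le.
  - move=> A mA; rewrite ME /unif_nodes.
    rewrite ge0_sume_distrr; last by move=> *; exact: measure_ge0.
    rewrite -(perm_big _ pws) /= (big_nth [::]) szw big_mkord; apply: eq_bigr => j _.
    rewrite diracE; case: (boolP (nth [::] ws j \in A)) => jA.
      rewrite mule1 -(lebR_slice n j S0); congr lebR.
      apply/seteqP; split => x /=; first by case.
      by split => //; split => //; move: jA; rewrite inE.
    rewrite mule0 -(measure0 lebR); congr lebR; apply/seteqP; split => x //=.
    by case=> -[/= jA' _]; move: jA; rewrite notin_setE.
  - move=> B mB; rewrite ME -(sum_lebR_slices n B) //; apply: eq_bigr => j _.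
    congr lebR; apply/seteqP; split => x /=; first by case=> -[].
    by case.
  (* Every slice, paired with its node, lies in [C], so [C] has full mass. *)
  - rewrite ME (eq_bigr (fun=> (n%:R^-1)%:E)).
      rewrite sumEFin sumr_const card_ord.
      have -> : n%:R^-1 *+ n = 1 :> R by rewrite -[LHS]mulr_natr mulVf ?lt0r_neq0.
      rewrite lee_fin.
      by rewrite gerBl addr_ge0 // ltW.
    move=> j _; rewrite -(lebR_slice n j S0); congr lebR.
    apply/seteqP; split => x /=; first by case.
    move=> xs; split => //; move: xs; rewrite /slice /= in_itv /= => /andP[/ltW x1 x2].
    have jx : j%:R / n%:R <= x <= j.+1%:R / n%:R by rewrite x1 x2.
    by split => /=; [exact: wS|exact: slice01 jx|exact: close].
apply/andP; split.
  by apply: lb_le_inf; [exists (a + b); exact: key|move=> e [/ltW]].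
by apply: ge_inf => //; exists 0 => e [/ltW].
Qed.

End TreeDistance.

(** A deterministic bound; [K] absorbs the early times at which the typical estimates may fail. In
    [c], the count differs from the record time [i] by at most [e * n + K], and [i] from [k / p] by
    at most [(e * n + K) / p]. *)
Lemma ghp_bst_le {R : realType} (q e K : R) (b : nat -> nat -> bool) n :
  q < 1 -> 0 <= e -> 0 <= K -> (0 < n)%N -> uniq (Iseq b n) ->
  (forall i, (i <= n)%N -> (top (Iseq b i))%:R <= (1 + e) * i%:R + K) ->
  (forall i, (i <= n)%N -> `|(nrec (Iseq b i))%:R - (1 - q) * i%:R| <= e * i%:R + K) ->
  forall p c, p = 1 - q -> c = (e * n%:R + K) * (1 + p^-1) ->
  0 <= ghp_bst q b n <=
    (c + p^-1 + 1) / n%:R + (2 * c + p^-1) / (p * n%:R).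
Proof.
move=> q1 e0 K0 n0 us topP nrecP p c pE cE; have p0 : 0 < p by rewrite pE subr_gt0.
have bstE : bst (Pi b n) = bst_fuel n (Iseq b n).
  by rewrite /Pi bst_rel_order /bst size_Iseq.
have sz : size (bst (Pi b n)) = n by rewrite bstE size_bst_fuel ?size_Iseq.
have countS w k : w \in bst (Pi b n) -> (k <= (lead w).+1)%N ->
    `|(count (fun v => lead v < k)%N (bst (Pi b n)))%:R - k%:R / p| <= c.
  move=> wS kw; have kn : (k <= nrec (Iseq b n))%N.
    by apply: leq_trans kw _; apply: (@lead_bst_fuel n); rewrite -bstE.
  have [i [i_n ik h1 h2]] := count_lead_bst b n k us kn.
  have t := topP i i_n; have r := nrecP i i_n; rewrite ik -pE in r.
  rewrite -(ler_nat R) in h1; rewrite -(ler_nat R) in h2.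
  have ein : e * i%:R <= e * n%:R by rewrite ler_wpM2l // ler_nat.
  set Nk := (count _ _)%:R in h1 h2 *.
  have g1 : `|Nk - i%:R| <= e * n%:R + K.
    by rewrite ger0_norm ?subr_ge0 //; lra.
  have g2 : `|i%:R - k%:R / p| <= (e * n%:R + K) / p.
    have -> : i%:R - k%:R / p = - (k%:R - p * i%:R) / p.
      by field; rewrite lt0r_neq0.
    rewrite normrM normrN (gtr0_norm (x := p^-1)) ?invr_gt0 //.
    by rewrite ler_pM2r ?invr_gt0 //; lra.
  have -> : Nk - k%:R / p = (Nk - i%:R) + (i%:R - k%:R / p) by ring.
  apply: le_trans (ler_normD _ _) _; rewrite cE mulrDr mulr1; exact: lerD.
have uS : uniq (bst (Pi b n)) by rewrite bstE bst_fuel_uniq.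
have clS : prefix_closed (bst (Pi b n)).
  by rewrite bstE => u r; exact: bst_fuel_prefix.
have S0 : (0 < size (bst (Pi b n)))%N by rewrite sz.
have := dGHP_tree p c (bst (Pi b n)) p0 uS clS S0 countS.
by rewrite sz /ghp_bst -pE.
Qed.

(** * Almost sure convergence from the deterministic bound *)

Theorem theorem1p4 (R : realType) (q : R) (d : measure_display)
  (T : measurableType d) (P : probability T R) (B : nat -> nat -> T -> bool) :
  0 <= q < 1 -> bernoulli_iid_family P q B ->
  {ae P, forall w, ghp_bst q (fun i j => B i j w) n @[n --> \oo] --> 0}.
Proof.
move=> /andP[q0 q1] iidB; set p := 1 - q; have p0 : 0 < p by rewrite subr_gt0.
have typ k := Iseq_typical P q B q0 q1 iidB (p / k.+1%:R).
(* Countably many tolerances suffice, so a single null set serves them all. *)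
have {}typ : {ae P, forall w, forall k : nat, \forall n \near \oo,
    [/\ uniq (Iseq (fun i j => B i j w) n),
        (top (Iseq (fun i j => B i j w) n))%:R <= (1 + p / k.+1%:R) * n%:R &
        `|(nrec (Iseq (fun i j => B i j w) n))%:R - p * n%:R| <= p / k.+1%:R * n%:R]}.
  apply: ae_foralln => k; apply: typ; first by rewrite divr_gt0.
  by rewrite ler_pdivrMr // ler_peMr ?ler1n // ltW.
apply: filterS typ => w typ; set b := fun i j => B i j w.
(* [A] is the coefficient of [e] in the final bound, and [D / n] below is the remainder that
   vanishes. *)
pose A := (1 + p^-1) * (1 + 2 / p); have A0 : 0 < A.
  by rewrite mulr_gt0 // ltr_wpDr ?divr_ge0 ?invr_ge0 // ltW.
apply/cvgrPdist_le => eta eta0.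
have [k ke] : exists k : nat, p / k.+1%:R * A <= eta / 2.
  exists (Num.truncn (p * A / (eta / 2))).
  rewrite mulrAC ler_pdivrMr // [leRHS]mulrC -ler_pdivrMr ?divr_gt0 //.
  by rewrite ltW // truncnS_gt.
have := typ k; set e := p / k.+1%:R in ke * => -[n0 _ typk].
have e0 : 0 <= e by rewrite divr_ge0 // ltW.
(* Large enough to dominate [top], [nrec] and [i] at all times before [n0]. *)
pose K := (\sum_(i < n0) (top (Iseq b i) + nrec (Iseq b i)) + n0)%N.
have small i : (i < n0)%N ->
    [/\ (top (Iseq b i) <= K)%N, (nrec (Iseq b i) <= K)%N & (i <= K)%N].
  move=> i0; have h : (top (Iseq b i) + nrec (Iseq b i) + n0 <= K)%N.
    by rewrite /K leq_add2r (bigD1 (Ordinal i0)) //= leq_addr.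
  split; apply: leq_trans h; first by rewrite -addnA leq_addr.
    by rewrite addnAC leq_addl.
  by rewrite (leq_trans (ltnW i0)) // leq_addl.
have K0 : 0 <= K%:R :> R by [].
pose D := K%:R * A + p^-1 + 1 + p^-1 / p.
have D0 : 0 < D.
  have h1 : 0 <= K%:R * A by rewrite mulr_ge0 // ltW.
  have h2 : 0 < p^-1 by rewrite invr_gt0.
  have h3 : 0 < p^-1 / p by rewrite divr_gt0.
  by rewrite /D; lra.
pose n1 := (Num.truncn (D / (eta / 2))).+1.
exists (maxn n0 n1) => // n /=; rewrite geq_max => /andP[n0n n1n].
have [us _ _] := typk n n0n.
have npos : (0 < n)%N by rewrite (leq_trans _ n1n).
have nR : 0 < n%:R :> R by rewrite ltr0n.
have topP i : (i <= n)%N -> (top (Iseq b i))%:R <= (1 + e) * i%:R + K%:R.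
  move=> _; have [/small[h _ _]|/typk[_ h _]] := ltnP i n0.
    apply: ler_wpDl; first by rewrite mulr_ge0 ?addr_ge0.
    by rewrite ler_nat.
  by apply: le_trans h _; rewrite lerDl.
have nrecP i : (i <= n)%N -> `|(nrec (Iseq b i))%:R - p * i%:R| <= e * i%:R + K%:R.
  move=> _; have [/small[_ k1 k2]|/typk[_ _ h]] := ltnP i n0; last first.
    by apply: le_trans h _; rewrite lerDl.
  apply: ler_wpDl; first by rewrite mulr_ge0.
  rewrite -(ler_nat R) in k1; rewrite -(ler_nat R) in k2.
  have p1 : p <= 1 by rewrite gerBl.
  have h3 : p * i%:R <= i%:R by rewrite ler_piMl.
  have h4 : 0 <= p * i%:R by rewrite mulr_ge0 // ltW.
  have h5 : 0 <= (nrec (Iseq b i))%:R :> R by [].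
  by rewrite ler_norml; apply/andP; split; lra.
have /andP[g0 g1] := ghp_bst_le q e K%:R b n q1 e0 K0 npos us topP nrecP p _ erefl erefl.
rewrite sub0r normrN ger0_norm //; apply: le_trans g1 _.
have boundE (x y z t : R) : 0 < x -> 0 < t ->
    ((y * t + z) * (1 + x^-1) + x^-1 + 1) / t +
    (2 * ((y * t + z) * (1 + x^-1)) + x^-1) / (x * t) =
    y * ((1 + x^-1) * (1 + 2 / x)) +
    (z * ((1 + x^-1) * (1 + 2 / x)) + x^-1 + 1 + x^-1 / x) / t.
  by move=> x0 t0; field; rewrite !lt0r_neq0.
rewrite boundE // -/A -/D.
have h : D / n%:R <= eta / 2.
  rewrite ler_pdivrMr // [leRHS]mulrC -ler_pdivrMr ?divr_gt0 //.
  apply: (@le_trans _ _ n1%:R); last by rewrite ler_nat.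
  by rewrite ltW // truncnS_gt.
by lra.
Qed.
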